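(* Let $\alpha$ be a Perron number of degree $r$ with conjugates $\alpha_1=\alpha,\alpha_2,\dots,\alpha_r$. The map $\iota:\mathbb{N}_0^{r-1}\to\Omega_0$, $\kappa\mapsto s_\kappa$, is injective if and only if $\mathcal{R}_\alpha\cap\mathcal{H}_0=\{0\}$.
   Context: $\mathbb{N}_0=\{0,1,2,\dots\}$. A Perron number is a real algebraic integer $\alpha>1$ such that all of its other conjugates are strictly smaller than $\alpha$ in modulus. The degree and conjugates are taken over $\mathbb{Q}$; the conjugates are listed as $\alpha_1=\alpha,\alpha_2,\dots,\alpha_r$. For a multi-index $\kappa=(\kappa_2,\dots,\kappa_r)\in\mathbb{N}_0^{r-1}$ (indexed from $2$ to $r$), put $|\kappa|=\kappa_2+\dots+\kappa_r$ and $$s_\kappa=-|\kappa|+\frac{\log|\alpha_2^{\kappa_2}\cdots\alpha_r^{\kappa_r}|}{\log\alpha}+i\,\frac{\arg(\alpha_2^{\kappa_2}\cdots\alpha_r^{\kappa_r})}{\log\alpha},$$ where $\arg$ is the principal argument with values in $(-\pi,\pi]$. Let $\Omega_0=\{s\in\mathbb{C} : -\frac{\pi}{\log\alpha}<\Im(s)\le\frac{\pi}{\log\alpha}\}$. The indexation map is $\iota:\mathbb{N}_0^{r-1}\to\Omega_0$, $\iota(\kappa)=s_\kappa$. The module of relations of $\alpha$ is $\mathcal{R}_\alpha=\{(m_1,\dots,m_r)\in\mathbb{Z}^r : \alpha_1^{m_1}\cdots\alpha_r^{m_r}=1\}$, and $\mathcal{H}_0=\{(m_1,\dots,m_r)\in\mathbb{Z}^r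 : m_1+\dots+m_r=0\}$. *)

(* Defs.v *)
From mathcomp Require Import all_boot all_order all_algebra.
From mathcomp Require Import complex.
From mathcomp Require Import boolp classical_sets functions reals trigo exp.

Set Implicit Arguments.
Unset Strict Implicit.
Unset Printing Implicit Defensive.

Import Order.TTheory GRing.Theory Num.Theory.
Import ComplexField.Normc.

Local Open Scope classical_set_scope.
Local Open Scope ring_scope.
Local Open Scope complex_scope.

Section Arg.
Variable R : realType.
Implicit Types z : R[i].

(* The polar angles of [z] in ]-pi, pi].  For [z = 0] this is all of
   ]-pi, pi], so that [Arg 0] is unspecified within that interval. *)
Definition principal_angles z : set R :=
  [set t | - pi < t <= pi /\ z = (normc z)%:C * (cos t +i* sin t)].

Definition Arg z : R := xget 0 (principal_angles z).

Lemma Arg_spec z : principal_angles z (Arg z).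
Proof.
rewrite /Arg; apply: xgetPex; rewrite /principal_angles.
have pi0 : 0 < pi :> R := pi_gt0 R.
have [->|z0] := eqVneq z 0.
  exists 0; split; last by rewrite (normc0 R) mul0r.
  by rewrite oppr_lt0 pi0 ltW.
case: z z0 => x y z0; set r := normc _.
have r0 : 0 < r.
  rewrite lt_neqAle sqrtr_ge0 andbT eq_sym.
  by apply: contra z0 => /eqP/eq0_normc ->.
have rE : r ^+ 2 = x ^+ 2 + y ^+ 2.
  by rewrite /r /normc sqr_sqrtr // addr_ge0 // sqr_ge0.
have ux : `|x / r| <= 1.
  rewrite normrM normfV (gtr0_norm r0) ler_pdivrMr // mul1r.
  rewrite -(ger0_norm (ltW r0)) -ler_sqr ?nnegrE // !real_normK ?num_real // rE.
  by rewrite lerDl sqr_ge0.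
have u1 : -1 <= x / r <= 1 by rewrite -ler_norml.
have cosE : r * cos (acos (x / r)) = x.
  by rewrite acosK ?in_itv //= mulrC divfK ?gt_eqF.
have sinE : r * sin (acos (x / r)) = `|y|.
  rewrite sin_acos // -{1}(gtr0_norm r0) -sqrtr_sqr -sqrtrM ?sqr_ge0 //.
  rewrite mulrBr mulr1 -exprMn [r * _]mulrC divfK ?gt_eqF //.
  by rewrite rE addrAC subrr add0r sqrtr_sqr.
have polE t : r%:C * (cos t +i* sin t) = (r * cos t) +i* (r * sin t).
  by apply/eqP; rewrite eq_complex /= !mul0r subr0 addr0 !eqxx.
have [y0|y0] := leP 0 y.
  exists (acos (x / r)); split; last by rewrite polE cosE sinE ger0_norm.
  rewrite acos_lepi // andbT (lt_le_trans _ (acos_ge0 u1)) //.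
  by rewrite oppr_lt0.
exists (- acos (x / r)); split; last first.
  by rewrite polE cosN sinN mulrN cosE sinE ltr0_norm // opprK.
apply/andP; split; last first.
  by apply: le_trans (ltW pi0); rewrite oppr_le0 acos_ge0.
rewrite ltrN2 lt_neqAle acos_lepi // andbT; apply/eqP => acospi.
by move: sinE; rewrite acospi sinpi mulr0 => /esym/eqP; rewrite normr_eq0 lt_eqF.
Qed.

End Arg.

Section Perron.
Variable R : realType.

Definition is_minpoly (a : R) (p : {poly rat}) : Prop :=
  [/\ p \is monic, irreducible_poly p & root (map_poly ratr p) a].

Definition conjugate (a : R) (z : R[i]) : Prop :=
  exists2 p : {poly rat}, is_minpoly a p & root (map_poly ratr p) z.

Definition has_degree (a : R) (r : nat) : Prop :=
  exists2 p : {poly rat}, is_minpoly a p & size p = r.+1.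

Definition perron (a : R) : Prop :=
  [/\ integralOver (intr : int -> R) a, 1 < a &
      forall z, conjugate a z -> z != a%:C -> normc z < a].

(* The family [c] is indexed from [0]: [c ord0] is alpha_1 and, for
   [j : 'I_n], [c (lift ord0 j)] is alpha_(j+2); the degree is [n.+1]. *)
Definition lists_conjugates n (a : R) (c : 'I_n.+1 -> R[i]) : Prop :=
  [/\ c ord0 = a%:C, injective c &
      forall z, conjugate a z <-> exists i, c i = z].

End Perron.

Section Indexation.
Variables (R : realType) (n : nat).
Implicit Types (a : R) (c : 'I_n.+1 -> R[i]).
Implicit Types kappa : {ffun 'I_n -> nat}.

Definition weight kappa : nat := (\sum_j kappa j)%N.

Definition conj_monomial c kappa : R[i] :=
  \prod_j c (lift ord0 j) ^+ kappa j.

Definition s_ a c kappa : R[i] :=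
  (- (weight kappa)%:R + ln (normc (conj_monomial c kappa)) / ln a)
  +i* (Arg (conj_monomial c kappa) / ln a).

Definition Omega0 a : set R[i] :=
  [set s : R[i] | - (pi / ln a) < complex.Im s <= pi / ln a].

Lemma s_Omega0 a c kappa : perron a -> s_ a c kappa \in Omega0 a.
Proof.
case=> _ a1 _; have lna : 0 < ln a by rewrite ln_gt0.
apply/mem_set; rewrite /Omega0 /= -mulNr ltr_pM2r ?ler_pM2r ?invr_gt0 //.
by have [] := Arg_spec (conj_monomial c kappa).
Qed.

Definition iota_map a c (ha : perron a) kappa : set_type (Omega0 a) :=
  exist _ (s_ a c kappa) (s_Omega0 c kappa ha).

Definition relations_module c :=
  [set m : {ffun 'I_n.+1 -> int} | \prod_i c i ^ m i = 1].

Definition H0 := [set m : {ffun 'I_n.+1 -> int} | \sum_i m i = 0].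

End Indexation.

Arguments H0 : clear implicits.

(* Main.v *)
(** [s_kappa = s_kappa'] says that the monomials [x], [y] of [kappa],
    [kappa'] satisfy [x * alpha ^ |kappa'| = y * alpha ^ |kappa|]: the
    imaginary part determines the argument and the real part the logarithm of
    [|x| * alpha ^ (- |kappa|)]. This is a multiplicative relation whose
    exponents, [|kappa'| - |kappa|] at [alpha] and [kappa - kappa'] at the
    other conjugates, sum to zero; splitting exponents into positive and
    negative parts shows that every element of [H0] arises in this way. *)
Require Import Defs.
From mathcomp Require Import all_boot all_order all_algebra.
From mathcomp Require Import complex.
From mathcomp Require Import boolp classical_sets functions reals trigo exp.

Import Order.TTheory GRing.Theory Num.Theory.
Import ComplexField.Normc.

Local Open Scope classical_set_scope.
Local Open Scope ring_scope.
Local Open Scope complex_scope.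

Section Polar.
Variable R : realType.
Implicit Types (t : R) (z : R[i]).

Lemma normc_scale t z : 0 < t -> normc (t%:C * z) = t * normc z.
Proof.
by move=> t0; rewrite normcM /normc /= expr0n addr0 sqrtr_sqr gtr0_norm.
Qed.

(** The two sets of principal angles coincide, so [xget] selects the same element from both; this
    covers [z = 0] as well. *)
Lemma Arg_scale t z : 0 < t -> Arg (t%:C * z) = Arg z.
Proof.
move=> t0; rewrite /Arg; congr xget; apply/seteqP.
have tC0 : t%:C != 0 :> R[i].
  by apply/eqP => -[] /eqP; rewrite gt_eqF.
split=> u [hu /= zE]; split=> //.
  by apply: (mulfI tC0); rewrite zE normc_scale // rmorphM mulrA.
by rewrite normc_scale // rmorphM /= -mulrA -zE.
Qed.

Lemma eq_normc_Arg z1 z2 : normc z1 = normc z2 -> Arg z1 = Arg z2 -> z1 = z2.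
Proof.
move=> eN eA; have [_ ->] := Arg_spec z1; have [_ ->] := Arg_spec z2.
by rewrite eN eA.
Qed.

Lemma normc_gt0 z : z != 0 -> 0 < normc z.
Proof.
move=> z0; rewrite lt_neqAle eq_sym; apply/andP; split; last first.
  by case: z {z0} => x y; rewrite /normc sqrtr_ge0.
by apply: contra z0 => /eqP/eq0_normc ->.
Qed.

End Polar.

(** If 0 were a conjugate, ['X] would divide the irreducible [p] over the rationals, hence be
    associate to it, and the root [a] of [p] would be 0. *)
Lemma conjugate_neq0 (R : realType) (a : R) (z : R[i]) :
  a != 0 -> conjugate a z -> z != 0.
Proof.
move=> a0 [p [_ [_ irr_p] pa] pz]; apply: contra a0 => /eqP z0.
move: pz; rewrite z0 -(rmorph0 (@ratr R[i])) fmorph_root -dvdp_XsubCl subr0.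
move=> Xp; have := irr_p 'X; rewrite size_polyX => /(_ isT Xp) Xp'.
move: pa; rewrite -(eqp_root (p := map_poly ratr 'X)).
  by rewrite map_polyX rootX.
by rewrite eqp_map.
Qed.

Section Indexation.
Variables (R : realType) (n : nat).
Implicit Types (a : R) (c : 'I_n.+1 -> R[i]).
Implicit Types kappa : {ffun 'I_n -> nat}.

Lemma s_eqP a c k1 k2 : 1 < a -> conj_monomial c k1 != 0 ->
    conj_monomial c k2 != 0 ->
  s_ a c k1 = s_ a c k2 <->
  (a%:C) ^+ weight k2 * conj_monomial c k1
  = (a%:C) ^+ weight k1 * conj_monomial c k2.
Proof.
rewrite /s_; set x := conj_monomial c k1; set y := conj_monomial c k2.
move=> a1 x0 y0; have a0 : 0 < a by apply: lt_trans a1.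
have lna : ln a != 0 by rewrite gt_eqF ?ln_gt0.
have aX m : 0 < a ^+ m by rewrite exprn_gt0.
have lnE m z : z != 0 ->
    ln (normc ((a%:C) ^+ m * z)) / ln a = m%:R + ln (normc z) / ln a.
  move=> z0; rewrite -rmorphXn normc_scale // lnM ?posrE ?normc_gt0 //.
  by rewrite lnXn // mulrDl mulrnAl divff.
have ArgE m z : Arg ((a%:C) ^+ m * z) = Arg z by rewrite -rmorphXn Arg_scale.
have aC0 m : (a%:C) ^+ m != 0 :> R[i].
  by rewrite -rmorphXn; apply/eqP => -[] /eqP; rewrite gt_eqF.
split=> [[eRe /(mulIf (invr_neq0 lna)) eA]|e].
  apply: eq_normc_Arg; last by rewrite !ArgE.
  apply: ln_inj; rewrite ?posrE ?normc_gt0 ?mulf_neq0 //.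
  apply: (mulIf (invr_neq0 lna)); rewrite !lnE //.
  (* Subtracting both weights turns the two sides into the real parts of [s_ a c k1] and
     [s_ a c k2]. *)
  apply: (addrI (- (weight k1)%:R - (weight k2)%:R)).
  by rewrite addrA subrK eRe addrACA addNr add0r.
congr (_ +i* _); last by rewrite -(ArgE (weight k2) x) e ArgE.
have := lnE (weight k2) x x0; rewrite e lnE // => eRe.
apply: (addrI (weight k1)%:R); apply: (addrI (weight k2)%:R).
by rewrite addNKr -eRe addrCA addNKr.
Qed.

(** The entry at [ord0] is the one that makes all exponents sum to zero. *)
Definition exponent_diff kappa kappa' : {ffun 'I_n.+1 -> int} :=
  [ffun i => if unlift ord0 i is Some j then (kappa j)%:Z - (kappa' j)%:Z
             else (weight kappa')%:Z - (weight kappa)%:Z].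

Lemma exponent_diff0 k1 k2 :
  exponent_diff k1 k2 ord0 = (weight k2)%:Z - (weight k1)%:Z.
Proof. by rewrite ffunE unlift_none. Qed.

Lemma exponent_diff_lift k1 k2 j :
  exponent_diff k1 k2 (lift ord0 j) = (k1 j)%:Z - (k2 j)%:Z.
Proof. by rewrite ffunE liftK. Qed.

Lemma weightZ kappa : (weight kappa)%:Z = \sum_j (kappa j)%:Z.
Proof. exact: (big_morph Posz PoszD). Qed.

Lemma exponent_diff_H0 k1 k2 : H0 n (exponent_diff k1 k2).
Proof.
rewrite /H0 /= big_ord_recl (eq_bigr _ (fun j _ => exponent_diff_lift k1 k2 j)).
by rewrite exponent_diff0 !weightZ sumrB addrC subrKA subrr.
Qed.

(** The entries away from [ord0] determine an element of [H0], so it suffices to split each of these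
    into its positive and negative parts. *)
Lemma H0_exponent_diff m : H0 n m -> exists k1 k2, m = exponent_diff k1 k2.
Proof.
rewrite /H0 /= big_ord_recl => mH.
(* Negative integers are sent to 0, so [pos (- x)] is the negative part of [x]. *)
pose pos (x : int) := if x is Posz k then k else 0%N.
have posE x : (pos x)%:Z - (pos (- x))%:Z = x.
  by case: x => [[|k]|k]; rewrite ?subr0 ?sub0r.
exists [ffun j => pos (m (lift ord0 j))], [ffun j => pos (- m (lift ord0 j))].
apply/ffunP => i; case: (unliftP ord0 i) => [j|] ->.
  by rewrite exponent_diff_lift !ffunE posE.
rewrite exponent_diff0 !weightZ -sumrB; move/eqP: mH; rewrite addr_eq0 => /eqP ->.
by rewrite -sumrN; apply: eq_bigr => j _; rewrite !ffunE -{1}(posE (m _)) opprB.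
Qed.

Lemma exponent_diff_eq0 k1 k2 : exponent_diff k1 k2 = 0 <-> k1 = k2.
Proof.
split=> [/ffunP e|->]; apply/ffunP.
  move=> j; have := e (lift ord0 j); rewrite exponent_diff_lift ffunE.
  by move/eqP; rewrite subr_eq0 => /eqP[].
by move=> i; rewrite !ffunE; case: unlift => [j|]; rewrite subrr.
Qed.

Lemma conj_monomial_neq0 c kappa :
  (forall i, c i != 0) -> conj_monomial c kappa != 0.
Proof.
by move=> c0; apply/prodf_neq0 => j _; rewrite expf_neq0.
Qed.

(** Since no [c i] vanishes, integer powers split into quotients, and the product in the relation is
    the left side of the equation divided by the right side. *)
Lemma exponent_diff_relation c k1 k2 : (forall i, c i != 0) ->
  relations_module c (exponent_diff k1 k2) <->
  c ord0 ^+ weight k2 * conj_monomial c k1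
  = c ord0 ^+ weight k1 * conj_monomial c k2.
Proof.
move=> c0; rewrite /relations_module /= big_ord_recl exponent_diff0.
under eq_bigr do rewrite exponent_diff_lift expfzDr // -exprnP -exprnN.
rewrite expfzDr // -exprnP -exprnN prodf_div -/(conj_monomial c k1).
rewrite -/(conj_monomial c k2) mulf_div.
have d0 : c ord0 ^+ weight k1 * conj_monomial c k2 != 0.
  by rewrite mulf_neq0 ?expf_neq0 ?conj_monomial_neq0.
by split=> [/divr1_eq //|->]; rewrite divff.
Qed.

End Indexation.

Theorem theorem4p4 (R : realType) (n : nat) (alpha : R)
    (c : 'I_n.+1 -> R[i]) (halpha : perron alpha)
    (hdeg : has_degree alpha n.+1) (hc : lists_conjugates alpha c) :
  injective (iota_map c halpha) <->
  relations_module c `&` H0 n = [set 0].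
Proof.
have [_ a1 _] := halpha; have [ca _ cP] := hc.
have a0 : alpha != 0 by rewrite gt_eqF // (lt_trans ltr01).
have c0 i : c i != 0 by apply: (conjugate_neq0 _ _ _ a0); apply/cP; exists i.
have s_relation k1 k2 : s_ alpha c k1 = s_ alpha c k2 <->
    relations_module c (exponent_diff _ k1 k2).
  rewrite exponent_diff_relation // ca.
  by apply: s_eqP; rewrite ?conj_monomial_neq0.
split=> [inj|rel0 k1 k2 /(congr1 val) /= /s_relation rel].
  apply/seteqP; split=> [m [rel /H0_exponent_diff[k1 [k2 mE]]]|_ ->] /=.
    rewrite mE; apply/exponent_diff_eq0/inj/val_inj/s_relation.
    by rewrite -mE.
  (* The zero vector is the difference of two equal multi-indices, so its membership follows from
     the reflexive case of [s_relation]. *)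
  have d0 := (exponent_diff_eq0 _ (0 : {ffun 'I_n -> nat}) 0).2 erefl.
  by rewrite -d0; split; [exact/s_relation | exact: exponent_diff_H0].
apply/exponent_diff_eq0; suff : [set 0] (exponent_diff _ k1 k2) by [].
by rewrite -rel0; split=> //; exact: exponent_diff_H0.
Qed.
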